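(* Let $0<\epsilon\leqslant\frac14$. For each prime $q$ put $\eta=q^{-\frac14+\epsilon}$. Then there exist constants $q_0(\epsilon)$ and $c(\epsilon)>0$ such that for all primes $q\geqslant q_0(\epsilon)$ we have $|P_\eta^{(2)}|\geqslant c(\epsilon)\,q$. Moreover one may take $c(\epsilon)=\left(\frac{2\epsilon}{3+4\epsilon}\right)^2(1+o(1))$, i.e. for fixed $\epsilon$, $$|P_\eta^{(2)}|\geqslant \left(\frac{2\epsilon}{3+4\epsilon}\right)^2(1+o(1))\,q\qquad\text{as } q\to\infty \text{ through primes};$$ in particular, one may take $c(\frac14)=\frac1{64}(1+o(1))$.
   Context: For a prime $q$ and a real number $0<\eta\leqslant 1$, $P_\eta=\{p : p \text{ prime},\ p<\eta q\}$, viewed as a subset of $(\mathbb{Z}/q\mathbb{Z})^\times$ via reduction modulo $q$. For a subset $S$ of an abelian group written multiplicatively and $k\geqslant 1$, the $k$-fold iterated product set is $S^{(k)}=\{s_1s_2\cdots s_k : s_i\in S\}$ (the $s_i$ need not be distinct). Here $P_\eta^{(2)}\subseteq(\mathbb{Z}/q\mathbb{Z})^\times$, and $|\cdot|$ denotes cardinality. The notation $o(1)$ denotes a quantity tending to $0$ as $q\to\infty$ with $\epsilon$ fixed. *)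

(* Defs.v *)
From mathcomp Require Import all_boot all_order all_algebra all_fingroup.
From mathcomp Require Import boolp reals exp.

Set Implicit Arguments.
Unset Strict Implicit.
Unset Printing Implicit Defensive.

Local Open Scope ring_scope.

(* Intended for q prime and eta <= 1: each prime p < eta * q is then smaller
   than q, so its residue is a unit and ranging over units loses nothing. *)
Definition primes_below (R : realType) (q : nat) (eta : R) : {set {unit 'Z_q}} :=
  [set u : {unit 'Z_q} |
    `[< exists p : nat, [/\ prime p, p%:R < eta * q%:R & val u = p%:R] >]].

(* The power is taken in the monoid of subsets of {unit 'Z_q} under elementwise
   multiplication, so this is the set of all products u_1 * ... * u_k. *)
Definition primes_prod (R : realType) (q : nat) (eta : R) (k : nat) :
    {set {unit 'Z_q}} :=
  (primes_below q eta ^+ k)%g.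

Definition eta_of (R : realType) (eps : R) (q : nat) : R :=
  q%:R `^ (- 4^-1 + eps).

(* Main.v *)
Require Import Defs.
From mathcomp Require Import all_boot all_order all_algebra all_fingroup.
From mathcomp Require Import cyclic zify ring lra.
From mathcomp Require Import boolp reals topology normedtype sequences exp.
Import Order.TTheory GRing.Theory Num.Theory.
Import numFieldNormedType.Exports.

Set Implicit Arguments.
Unset Strict Implicit.
Unset Printing Implicit Defensive.

Local Open Scope ring_scope.

(** For every large prime [q], the products of two primes below [q^(3/4)] cover
at least [q / 64] residues.  This gives all the claims: [eta * q] is
[q^(3/4 + eps)], and [2 eps / (3 + 4 eps) <= 1/8] when [eps <= 1/4], so the
required density is at most [1/64] and the error term can be taken to be [0].

Let [U] be the set of residues of the primes below [N], about [q^(3/4)], and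
[A = U U].  For [u] in [U] and a prime [p < N] the residue [a = u p] lies in [A],
that is, [a x = p] with [x = u^-1].  So the pairs [(u, p)], about [|U| pi(N)] of
them, inject into the solutions of [a x = n] with [a] in [A], [x] in [U^-1] and
[n < N] prime.  If such solutions are at most about
[|A| |U| / q * C N / log N] in number, then [|A|] is at least a constant times
[q].  Only the variable [n] is sieved; [x] keeps running over the inverses of
the primes themselves.  Three ingredients make this work.

- A sieve.  A square [(\sum_(d | n, d <= z) lambda_d)^2], with weights in the
  manner of Selberg, is nonnegative, equals [1] at the primes above [z], and has
  mean [O(1 / log z)] over intervals ([selberg_form_le],
  [sum_divisor_weight_le]).

- Equidistribution.  To count the solutions of [a x = n] with [e | n] and [n] in
  an interval, write [n = t + s] with [t < N] and [s < M]: now [s = a x - t] says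
  that the point [(x, s)] lies on the line of slope [a] and intercept [- t].
  Point-line incidences over a field of [q] elements obey a second moment
  identity ([mean_zero_incidence]), which makes the number of solutions
  deviate from its expected value by at most [sqrt (q |A| |X| N M)], whatever [e]
  is ([divisible_excess_le]).  The variable [s] costs a factor [M] on
  both sides, since each [n] in [M, N) has [M] representations.

- A Chebyshev lower bound for [pi(N)], from the central binomial coefficient
  ([prime_count_ge]).

The result is the inequality [prime_pairs_le], whose error term, after division
by [M |U|], is at most [z^2 q sqrt (N / (M |U|))].  This is smaller than [pi(N)]
by a power of [q] as soon as [z^2 q] is well below [N^(3/2)], about [q^(9/8)].
With [z = q^(1/20)] the main term then gives the density [1/60 > 1/64], by
[sieve_inequality_density]. *)

(** * A Chebyshev lower bound *)

Lemma central_bin_ge (N : nat) :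
  (0 < N)%N -> (4 ^ N <= N.*2 * 'C(N.*2, N))%N.
Proof.
case: N => // N _; elim: N => // N IH; set n := N.+1.
have E1 := mul_bin_diag n.+1.*2 n.
have E2 := mul_bin_down n.*2.+1 n.
have E3 : (n.*2.+1 - n = n.+1)%N by lia.
rewrite E3 in E2.
rewrite expnS; move: E1 E2 IH => /=; rewrite -/n.
set x := 'C(n.+1.*2, _); set y := 'C(_, n) ; set c := 'C(n.*2, _).
nia.
Qed.

(** In the Legendre formula each exponent [k] contributes
[(2N) %/ p^k - 2 (N %/ p^k)], which is [0] or [1], and [0] once [p^k > 2N].  So
every prime power dividing the central binomial is at most [2N]. *)
Lemma logn_central_bin (N p : nat) :
  (0 < N)%N -> prime p -> (logn p 'C(N.*2, N) <= trunc_log p N.*2)%N.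
Proof.
move=> N0 pp; have p1 := prime_gt1 pp.
have Bgt0 : (0 < 'C(N.*2, N))%N by rewrite bin_gt0 -addnn leq_addr.
have Hf : ('C(N.*2, N) * (N`! * N`!) = N.*2`!)%N.
  by have := @bin_fact N.*2 N; rewrite -addnn addnK leq_addr => ->.
have : (logn p 'C(N.*2, N) + (logn p N`! + logn p N`!) = logn p N.*2`!)%N.
  by rewrite -Hf !lognM ?muln_gt0 ?fact_gt0 ?Bgt0.
rewrite !logn_fact //.
have -> : (\sum_(1 <= k < N.+1) N %/ p ^ k =
           \sum_(1 <= k < N.*2.+1) N %/ p ^ k)%N.
  rewrite [RHS](@big_cat_nat _ _ _ N.+1) //=; last by rewrite ltnS -addnn leq_addr.
  rewrite [X in (_ = _ + X)%N]big_nat_cond [X in (_ = _ + X)%N]big1 ?addn0 // => k.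
  rewrite andbT => /andP[hk _]; apply: divn_small.
  exact: leq_trans hk (ltnW (ltn_expl _ p1)).
set S := (\sum_(1 <= k < N.*2.+1) N %/ p ^ k)%N => HS.
have: (\sum_(1 <= k < N.*2.+1) N.*2 %/ p ^ k <=
       S + S + \sum_(1 <= k < N.*2.+1) (k <= trunc_log p N.*2))%N.
  rewrite -!big_split /=; apply: leq_sum => k _.
  have [hk|hk] := leqP k (trunc_log p N.*2).
    have pk : (0 < p ^ k)%N by rewrite expn_gt0 prime_gt0.
    by rewrite -[X in (X %/ _)%N]addnn divnD // leq_add2l leq_b1.
  rewrite divn_small //.
  by apply: leq_trans (trunc_log_ltn N.*2 p1) _; rewrite leq_exp2l.
rewrite -HS addnC leq_add2l => H; apply: leq_trans H _.
have hT : (trunc_log p N.*2 <= N.*2)%N.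
  by apply: leq_trans (ltnW (ltn_expl _ p1)) (trunc_logP p1 _); rewrite double_gt0.
rewrite (@big_cat_nat _ _ _ (trunc_log p N.*2).+1) //=.
rewrite (eq_big_nat _ _ (F2 := fun=> 1%N)); last first.
  by move=> k /andP[_]; rewrite ltnS => ->.
rewrite sum_nat_const_nat muln1 subn1 /= [X in (_ + X)%N]big_nat_cond big1 ?addn0 // => k.
by rewrite andbT => /andP[hk _]; rewrite leqNgt hk.
Qed.

Lemma central_bin_le (N : nat) :
  (0 < N)%N -> ('C(N.*2, N) <= N.*2 ^ (\sum_(p < N.*2.+1) prime p))%N.
Proof.
move=> N0.
have Bgt0 : (0 < 'C(N.*2, N))%N by rewrite bin_gt0 -addnn leq_addr.
have N20 : (0 < N.*2)%N by rewrite double_gt0.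
have Hpow p : prime p -> (p ^ logn p 'C(N.*2, N) <= N.*2)%N.
  move=> pp; apply: leq_trans (trunc_logP (prime_gt1 pp) N20).
  by rewrite leq_exp2l ?prime_gt1 // logn_central_bin.
rewrite {1}(prod_prime_decomp Bgt0) prime_decompE big_map /=.
apply: (@leq_trans (\prod_(p <- primes 'C(N.*2, N)) N.*2)%N).
  rewrite big_seq [leqRHS]big_seq; apply: leq_prod => p.
  by rewrite mem_primes => /andP[pp _]; exact: Hpow.
rewrite big_const_seq iter_muln_1 count_predT leq_pexp2l //.
rewrite -(big_mkord xpredT (fun p => prime p : nat)) -big_mkcond /=.
rewrite sum1_count -size_filter; apply: uniq_leq_size (primes_uniq _) _ => p.
rewrite mem_primes mem_filter mem_index_iota /= ltnS => /and3P[pp _ pB].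
rewrite pp; apply: leq_trans (Hpow _ pp); rewrite -{1}(expn1 p).
by rewrite leq_exp2l ?prime_gt1 // -pfactor_dvdn // expn1.
Qed.

(** Comparing the two bounds on the central binomial of order [2^(m-1)] gives
[2^(2^m) <= 2^(m (pi(2^m) + 1))]; the lower bound for [pi] has the constant
[ln 2], and no logarithm appears because the bound is taken at a power of [2]. *)
Lemma prime_count_ge (m : nat) :
  (1 < m)%N -> (2 ^ m <= m * (\sum_(p < 2 ^ m) prime p).+1)%N.
Proof.
case: m => [|[|n]] // _; set m := n.+2; set N := (2 ^ n.+1)%N.
have N0 : (0 < N)%N by rewrite expn_gt0.
have E2N : (N.*2 = 2 ^ m)%N by rewrite /m expnS mul2n.
have Hnp : prime (2 ^ m) = false.
  apply/negP => /primeP[_ /(_ 2)]; rewrite /m expnS dvdn_mulr // => /(_ isT).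
  have h : (0 < 2 ^ n)%N by rewrite expn_gt0.
  move=> /eqP; rewrite !expnS; lia.
have := leq_trans (central_bin_ge N0) (leq_mul (leqnn _) (central_bin_le N0)).
rewrite -expnS E2N big_ord_recr /= Hnp addn0 -expnM.
by rewrite (_ : (4 ^ N = 2 ^ (2 ^ m))%N) ?leq_exp2l // -E2N -mul2n expnM.
Qed.

(** * Squarefree numbers and Moebius inversion *)

Definition sqfree (n : nat) := (0 < n)%N && all (fun p => logn p n == 1%N) (primes n).

Lemma sqfree_gt0 n : sqfree n -> (0 < n)%N.
Proof. by case/andP. Qed.

Lemma sqfreeN_dvd n p : sqfree n -> prime p -> ~~ (p * p %| n)%N.
Proof.
case/andP=> n0 /allP h pp; rewrite mulnn pfactor_dvdn // -ltnNge ltnS.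
have [|] := boolP (p \in primes n); first by move=> /h /eqP ->.
by rewrite -logn_gt0 -leqNgt => h0; apply: leq_trans h0 _.
Qed.

Lemma sqfree_mul_sqr n : (0 < n)%N -> exists f m, sqfree f /\ (n = f * m ^ 2)%N.
Proof.
elim/ltn_ind: n => n IH n0.
have [sn|] := boolP (sqfree n); first by exists n, 1%N; rewrite muln1.
rewrite /sqfree n0 /= => /allPn[p pn lp].
have [pp _ _] := and3P (eq_ind _ is_true pn _ (mem_primes p n)).
have l2 : (1 < logn p n)%N.
  by rewrite ltn_neqAle eq_sym lp logn_gt0.
have := l2; rewrite -pfactor_dvdn // => /dvdnP[k nk].
have k0 : (0 < k)%N by case: k nk n0 => // ->.
have [||f [m [sf km]]] := IH k => //.
  by rewrite nk ltn_Pmulr // (leq_trans (prime_gt1 pp)) // -{1}(expn1 p) leq_exp2l // prime_gt1.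
by exists f, (m * p)%N; rewrite nk km expnMn mulnA.
Qed.

Section Sieve.
Variable R : realFieldType.

(** This is the Moebius function on squarefree numbers, the only arguments where
its value matters. *)
Definition moebius (n : nat) : R := (-1) ^+ size (primes n).

Lemma moebius1 : moebius 1 = 1.
Proof. by []. Qed.

Lemma moebius_sqr n : moebius n ^+ 2 = 1.
Proof. by rewrite /moebius -exprM mulnC exprM sqrrN expr1n expr1n. Qed.

Lemma normr_moebius n : `|moebius n| = 1.
Proof. by rewrite /moebius normrX normrN normr1 expr1n. Qed.

Lemma moebiusM p d : prime p -> (0 < d)%N -> ~~ (p %| d)%N ->
  moebius (p * d) = - moebius d.
Proof.
move=> pp d0 pd; rewrite /moebius.
have -> : size (primes (p * d)) = (size (primes d)).+1.
  rewrite -[RHS]/(size (p :: primes d)); apply/perm_size/uniq_perm.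
  - exact: primes_uniq.
  - by rewrite /= primes_uniq andbT mem_primes pp d0.
  by move=> x; rewrite (primesM _ (prime_gt0 pp) d0) primes_prime // inE in_cons.
by rewrite exprS mulN1r.
Qed.

(** Moebius inversion on the interval from [k] to [f] of the divisibility order.
When [k] is a proper divisor, multiplying or dividing by a fixed prime [p]
dividing [f %/ k] is a sign-reversing involution of the interval. *)
Lemma sum_moebius_interval z k f : sqfree f -> (f <= z)%N -> (k %| f)%N ->
  \sum_(d < z.+1 | (k %| d)%N && (d %| f)%N) moebius d = (k == f)%:R * moebius k.
Proof.
move=> sf fz kf; have f0 := sqfree_gt0 sf.
case: eqVneq => [->|kNf]; rewrite ?mul1r ?mul0r.
  have E : (nat_of_ord (inord f : 'I_z.+1)) = f by rewrite inordK.
  rewrite (big_pred1 (inord f)) ?E // => i /=; rewrite -eqn_dvd -val_eqE /= E.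
  by rewrite eq_sym.
have k0 := dvdn_gt0 f0 kf.
have fk1 : (1 < f %/ k)%N.
  have h := divnK kf; rewrite ltnNge; apply/negP => hle.
  case/negP: kNf; rewrite -h.
  case: (f %/ k)%N hle h => [|[|//]] _; last by rewrite mul1n.
  by rewrite mul0n => h; rewrite -h in f0.
have [p pp pfk] := pdivP fk1.
have p0 := prime_gt0 pp.
have kpf : (k * p %| f)%N by rewrite -(divnK kf) mulnC dvdn_pmul2r.
have pNk : ~~ (p %| k)%N.
  apply/negP => pk; case/negP: (sqfreeN_dvd sf pp).
  by apply: dvdn_trans kpf; rewrite dvdn_pmul2r.
have Hup d : (k %| d)%N -> (d %| f)%N -> ~~ (p %| d)%N -> (p * d %| f)%N.
  move=> kd df pd; rewrite Gauss_dvd ?prime_coprime // df andbT.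
  exact: dvdn_trans (dvdn_mull _ (dvdnn p)) kpf.
have Hdn d : (k %| d)%N -> (p %| d)%N -> (k %| d %/ p)%N.
  move=> kd pd; rewrite dvdn_divRL // mulnC Gauss_dvd ?prime_coprime ?kd ?pd //.
have HpN d : (d %| f)%N -> (p %| d)%N -> ~~ (p %| d %/ p)%N.
  move=> df pd; rewrite dvdn_divRL //; apply/negP => h.
  by case/negP: (sqfreeN_dvd sf pp); apply: dvdn_trans h df.
pose h (d : 'I_z.+1) : 'I_z.+1 := if (p %| d)%N then inord (d %/ p) else inord (p * d).
have hE (d : 'I_z.+1) : (k %| d)%N && (d %| f)%N ->
   h d = (if (p %| d) then d %/ p else p * d)%N :> nat.
  move=> /andP[kd df]; rewrite /h; case: ifPn => pd; rewrite inordK // ltnS.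
    by apply: leq_trans (leq_div _ _) _; rewrite -ltnS ltn_ord.
  by apply: leq_trans fz; apply: dvdn_leq => //; apply: Hup.
have hP (d : 'I_z.+1) : (k %| d)%N && (d %| f)%N -> (k %| h d)%N && (h d %| f)%N.
  move=> kdf; rewrite hE //; case/andP: kdf => kd df; case: ifPn => pd.
    rewrite Hdn //=; apply: dvdn_trans df; rewrite -{2}(divnK pd).
    exact: dvdn_mulr.
  by rewrite Hup // dvdn_mull.
have hK (d : 'I_z.+1) : (k %| d)%N && (d %| f)%N -> h (h d) = d.
  move=> kdf; apply: val_inj => /=; rewrite hE ?hP // hE //.
  case/andP: kdf => kd df; have [pd|pd] := boolP (p %| d)%N.
    by rewrite (negbTE (HpN d df pd)) mulnC divnK.
  by rewrite dvdn_mulr // mulKn.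
(* The involution h turns the sum into its opposite. *)
set S := (LHS); suff: S = - S by lra.
rewrite {1}/S (reindex_onto h h) //= -sumrN.
apply: eq_big => [d|d /andP[/andP[kd df] /eqP hd]].
  apply/andP/idP => [[kdf /eqP <-]|kdf]; first by rewrite hP.
  by rewrite hP // hK // eqxx.
have kdf : (k %| d)%N && (d %| f)%N by rewrite -hd hP // kd df.
have d0 : (0 < d)%N by case/andP: kdf => _ /(dvdn_gt0 f0).
rewrite hE //; case: ifPn => pd; last by rewrite moebiusM.
have d'0 : (0 < d %/ p)%N by rewrite divn_gt0 // dvdn_leq.
have [_ df'] := andP kdf.
by rewrite -{2}(divnK pd) mulnC moebiusM ?opprK // HpN.
Qed.

Lemma sqfree_dvd d n : (d %| n)%N -> sqfree n -> sqfree d.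
Proof.
move=> dn /andP[n0 /allP h]; have d0 := dvdn_gt0 n0 dn.
rewrite /sqfree d0; apply/allP => p pd.
have pn : p \in primes n.
  by move: pd; rewrite !mem_primes n0 d0 => /and3P[-> _ /dvdn_trans ->].
by rewrite eqn_leq logn_gt0 pd andbT -(eqP (h p pn)) dvdn_leq_log.
Qed.

(** * The sieve weights *)

Definition sqf_sum z : R := \sum_(f < z.+1 | sqfree f) f%:R^-1.

(** Selberg diagonalises the form [\sum_(d, e) l_d l_e / lcm (d, e)] in the
variables [y_k = \sum_(k | d) l_d / d].  These are the weights for which [y_k] is
[moebius k / (k * sqf_sum z)] at squarefree [k <= z].  The exact minimiser has
[totient k] in place of [k], here and in the normalising sum; the present choice
loses only a constant factor, and [sqf_sum z] is easier to bound below. *)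
Definition selberg z d : R :=
  moebius d * d%:R * (\sum_(f < z.+1 | sqfree f && (d %| f)%N) f%:R^-1) / sqf_sum z.

Lemma sqf_sum_gt0 z : (0 < z)%N -> 0 < sqf_sum z.
Proof.
move=> z0; have h1 : (1 < z.+1)%N by [].
rewrite /sqf_sum (bigD1 (Ordinal h1)) //= invr1 ltr_pwDl ?ltr01 //.
by apply: sumr_ge0 => i _; rewrite invr_ge0 ler0n.
Qed.

Lemma selberg0 z : selberg z 0 = 0.
Proof. by rewrite /selberg mulr0 !mul0r. Qed.

Lemma selberg1 z : (0 < z)%N -> selberg z 1 = 1.
Proof.
move=> z0; rewrite /selberg moebius1 !mul1r.
under eq_bigl do rewrite dvd1n andbT.
by rewrite divff // gt_eqF // sqf_sum_gt0.
Qed.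

(** The map [f |-> f %/ d] embeds the multiples of [d] among the squarefree [f <= z]
into the squarefree numbers up to [z], so the numerator of the weight is a part of
[sqf_sum z]. *)
Lemma normr_selberg_le1 z d : (0 < z)%N -> `|selberg z d| <= 1.
Proof.
move=> z0; case: (posnP d) => [->|d0]; first by rewrite selberg0 normr0 ler01.
have H0 := sqf_sum_gt0 z0.
rewrite /selberg !normrM normr_moebius mul1r (ger0_norm (ler0n _ _)).
rewrite (ger0_norm (sumr_ge0 _ _)); last by move=> i _; rewrite invr_ge0 ler0n.
rewrite normfV (gtr0_norm H0) ler_pdivrMr // mul1r.
pose P := [set f : 'I_z.+1 | sqfree f && (d %| f)%N].
pose h (f : 'I_z.+1) : 'I_z.+1 := inord (f %/ d).
have hE f : h f = (f %/ d)%N :> nat.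
  by rewrite inordK // ltnS (leq_trans (leq_div _ _)) // -ltnS.
have hinj : {in P &, injective h}.
  move=> f f'; rewrite !inE => /andP[_ df] /andP[_ df'] /(congr1 val) /=.
  by rewrite !hE => e; apply: val_inj; rewrite /= -(divnK df) e divnK.
have -> : d%:R * (\sum_(f < z.+1 | sqfree f && (d %| f)%N) f%:R^-1) =
    \sum_(f in P) (h f)%:R^-1 :> R.
  rewrite mulr_sumr; apply: eq_big => [f|f /andP[_ df]]; first by rewrite inE.
  have d0R : d%:R != 0 :> R by rewrite pnatr_eq0 -lt0n.
  by rewrite hE -{1}(divnK df) natrM invfM mulrCA mulfV ?mulr1.
rewrite -(big_imset (fun g : 'I_z.+1 => g%:R^-1) hinj) /= big_mkcond [leRHS]big_mkcond /=.
apply: ler_sum => g _; case: ifPn => [/imsetP[f]|_]; last first.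
  by case: ifP => // _; rewrite invr_ge0 ler0n.
rewrite inE => /andP[sf df] ->; rewrite hE (@sqfree_dvd _ f) //.
by rewrite -{2}(divnK df) dvdn_mulr.
Qed.

Lemma sum_totient_dvd_le z n : (0 < n <= z)%N ->
  (\sum_(k < z.+1 | k %| n) totient k = n)%N.
Proof.
case/andP=> n0 nz; rewrite -[RHS]sum_totient_dvd.
rewrite -(big_mkord (fun k => k %| n)%N totient) (@big_cat_nat _ _ _ n.+1) //=.
rewrite big_mkord [X in (_ + X)%N]big_nat_cond [X in (_ + X)%N]big1 ?addn0 // => k.
by case/andP=> /andP[nk _] /(dvdn_leq n0); rewrite leqNgt nk.
Qed.

(** The diagonal variables of the weights, by Moebius inversion. *)
Lemma sum_selberg_dvd z k : (k <= z)%N ->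
  \sum_(d < z.+1 | (k %| d)%N) selberg z d / d%:R =
    if sqfree k then moebius k / k%:R / sqf_sum z else 0.
Proof.
move=> kz; pose S d : R := \sum_(f < z.+1 | sqfree f && (d %| f)%N) f%:R^-1.
have lE d : selberg z d / d%:R = moebius d * S d / sqf_sum z.
  case: (posnP d) => [->|d0].
    rewrite selberg0 mul0r /S big1 ?mulr0 ?mul0r // => f.
    by rewrite dvd0n => /andP[/sqfree_gt0]; case: (nat_of_ord f).
  have d0R : d%:R != 0 :> R by rewrite pnatr_eq0 -lt0n.
  rewrite /selberg -/(S d) -[RHS](mulfK d0R); congr (_ / _).
  by set H := (sqf_sum z)^-1; ring.
under eq_bigr do rewrite lE.
rewrite -mulr_suml.
have -> : \sum_(d < z.+1 | (k %| d)%N) moebius d * S d =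
   \sum_(f < z.+1 | sqfree f) f%:R^-1 *
      \sum_(d < z.+1 | (k %| d)%N && (d %| f)%N) moebius d.
  under eq_bigr do rewrite /S mulr_sumr.
  rewrite (exchange_big_dep (fun f : 'I_z.+1 => sqfree f)) /=; last by move=> ? ? _ /andP[].
  apply: eq_bigr => f sf; rewrite mulr_sumr.
  by apply: eq_big => [d|d _]; [rewrite sf | rewrite mulrC].
transitivity ((\sum_(f < z.+1 | sqfree f) f%:R^-1 * ((k == f)%:R * moebius k)) / sqf_sum z).
  congr (_ / _); apply: eq_bigr => f sf; congr (_ * _).
  have [kf|kf] := boolP (k %| f)%N; first by rewrite sum_moebius_interval // -ltnS.
  rewrite big1; last by move=> d /andP[/dvdn_trans h /h]; rewrite (negbTE kf).
  by case: eqVneq kf => [->|_ _]; rewrite ?dvdnn ?mul0r.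
have kz1 : (k < z.+1)%N by [].
rewrite big_mkcond (bigD1 (Ordinal kz1)) //= eqxx mul1r big1 ?addr0.
  by case: ifP => _; rewrite ?mul0r // [_^-1 * _]mulrC.
move=> f; rewrite -val_eqE /= eq_sym => /negbTE ->.
by rewrite mul0r mulr0; case: ifP.
Qed.

(** Since [1 / lcm (d, e) = gcd (d, e) / (d e)] and a number is the sum of the
totients of its divisors, the form is [\sum_k totient k * y_k ^+ 2].  Here
[totient k <= k], which leaves [\sum_k 1 / k] over squarefree [k], divided by
[sqf_sum z ^+ 2]. *)
Lemma selberg_form_le z : (0 < z)%N ->
  \sum_(d < z.+1) \sum_(e < z.+1) selberg z d * selberg z e / (lcmn d e)%:R
    <= (sqf_sum z)^-1.
Proof.
move=> z0; have H0 := sqf_sum_gt0 z0.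
pose T d : R := selberg z d / d%:R.
have lE (d e : 'I_z.+1) : selberg z d * selberg z e / (lcmn d e)%:R =
   \sum_(k < z.+1) (totient k)%:R * ((k %| d)%N%:R * T d) * ((k %| e)%N%:R * T e).
  case: (posnP d) => [->|d0].
    by rewrite selberg0 !mul0r big1 // => k _; rewrite /T selberg0 !(mul0r, mulr0).
  case: (posnP e) => [->|e0].
    by rewrite selberg0 mulr0 mul0r big1 // => k _; rewrite /T selberg0 !(mul0r, mulr0).
  have g0 : (0 < gcdn d e)%N by rewrite gcdn_gt0 d0.
  have gz : (0 < gcdn d e <= z)%N.
    by rewrite g0 (leq_trans (dvdn_leq d0 (dvdn_gcdl _ _))) // -ltnS.
  transitivity ((gcdn d e)%:R * T d * T e).
    have l0 : (0 < lcmn d e)%N by rewrite lcmn_gt0 d0.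
    have := congr1 (fun n => n%:R : R) (muln_lcm_gcd d e); rewrite /T /= !natrM.
    have : (lcmn d e)%:R != 0 :> R by rewrite pnatr_eq0 -lt0n.
    have : d%:R != 0 :> R by rewrite pnatr_eq0 -lt0n.
    have : e%:R != 0 :> R by rewrite pnatr_eq0 -lt0n.
    move=> e0R d0R l0R h.
    have -> : (gcdn d e)%:R = d%:R * e%:R / (lcmn d e)%:R :> R by rewrite -h mulrC mulKf.
    by field; rewrite e0R d0R l0R.
  have -> : (gcdn d e)%:R = \sum_(k < z.+1 | (k %| gcdn d e)%N) (totient k)%:R :> R.
    by rewrite -natr_sum (sum_totient_dvd_le gz).
  rewrite !mulr_suml big_mkcond /=.
  apply: eq_bigr => k _; rewrite dvdn_gcd.
  by case: (k %| d)%N; case: (k %| e)%N; rewrite /= ?mul1r ?mul0r ?mulr0 ?mul0r.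
under eq_bigr do under eq_bigr do rewrite lE.
have -> : \sum_(d < z.+1) \sum_(e < z.+1) \sum_(k < z.+1)
      (totient k)%:R * ((k %| d)%N%:R * T d) * ((k %| e)%N%:R * T e) =
    \sum_(k < z.+1) (totient k)%:R * (\sum_(d < z.+1 | (k %| d)%N) T d) ^+ 2.
  under eq_bigr do rewrite exchange_big /=.
  rewrite exchange_big /=; apply: eq_bigr => k _.
  have -> : \sum_(d < z.+1 | (k %| d)%N) T d = \sum_(d < z.+1) (k %| d)%N%:R * T d.
    by rewrite big_mkcond; apply: eq_bigr => d _; case: ifP; rewrite ?mul1r ?mul0r.
  rewrite expr2 mulr_suml mulr_sumr; apply: eq_bigr => d _.
  by rewrite !mulr_sumr; apply: eq_bigr => e _; rewrite -mulrA.
rewrite (_ : (sqf_sum z)^-1 = sqf_sum z * (sqf_sum z)^-2); last first.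
  by rewrite expr2 invfM mulrA mulfV ?mul1r // gt_eqF.
rewrite {2}/sqf_sum mulr_suml [leRHS]big_mkcond /=; apply: ler_sum => k _.
rewrite sum_selberg_dvd; last by rewrite -ltnS.
case: ifPn => [sk|_]; last by rewrite expr0n mulr0.
have k0 : 0 < k%:R :> R by rewrite ltr0n sqfree_gt0.
rewrite !exprMn moebius_sqr mul1r !exprVn mulrA ler_pM2r ?invr_gt0 ?exprn_gt0 //.
rewrite expr2 invfM mulrA -[leRHS]mul1r ler_pM2r ?invr_gt0 //.
rewrite ler_pdivrMr // mul1r ler_nat -{2}(sum_totient_dvd k).
by rewrite (bigD1 ord_max) //= leq_addr.
Qed.

Lemma sum_inv_sqr_le2 n : \sum_(m < n) (m%:R : R) ^- 2 <= 2.
Proof.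
case: n => [|n]; first by rewrite big_ord0.
case: n => [|n]; first by rewrite big_ord_recr big_ord0 /= expr0n invr0 addr0.
suff: \sum_(m < n.+2) (m%:R : R) ^- 2 <= 2 - n.+1%:R^-1.
  by move/le_trans; apply; rewrite lerBlDr lerDl invr_ge0.
elim: n => [|n IH].
  rewrite !big_ord_recr big_ord0 /= expr0n invr0 !add0r expr1n invr1; lra.
rewrite big_ord_recr /=; apply: le_trans (lerD IH (lexx _)) _.
have n0 : 0 < n.+1%:R :> R by [].
have n1 : 0 < n.+2%:R :> R by [].
rewrite -addrA lerD2l -subr_ge0.
have -> : - n.+2%:R^-1 - (- n.+1%:R^-1 + n.+2%:R ^- 2) =
   n.+1%:R^-1 * (n.+2%:R ^- 2) :> R.
  have e : n.+2%:R = n.+1%:R + 1 :> R by rewrite -natr1.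
  move: n0 n1; rewrite e; move: (n.+1%:R : R) => x x0 x1.
  by field; rewrite !gt_eqF.
by rewrite mulr_ge0 ?invr_ge0 ?exprn_ge0 ?ler0n.
Qed.

(** Writing each [n <= z] as [f * m ^ 2] with [f] squarefree bounds the harmonic sum
by [sqf_sum z * \sum_m 1 / m ^ 2].  The terms at [0] vanish. *)
Lemma harmonic_le_sqf_sum z : \sum_(n < z.+1) (n%:R : R)^-1 <= 2 * sqf_sum z.
Proof.
have i0 n : 0 <= (n%:R : R)^-1 by rewrite invr_ge0 ler0n.
apply: (@le_trans _ _ (\sum_(f < z.+1 | sqfree f) \sum_(m < z.+1) (f%:R : R)^-1 * m%:R ^- 2)).
  apply: (@le_trans _ _ (\sum_(n < z.+1) \sum_(f < z.+1 | sqfree f) \sum_(m < z.+1)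
     (if (n : nat) == (f * m ^ 2)%N then (n%:R : R)^-1 else 0))).
    apply: ler_sum => n _; case: (posnP n) => [n0|n0].
      rewrite n0 invr0; apply: sumr_ge0 => f _; apply: sumr_ge0 => m _; by case: ifP.
    have [f [m [sf nfm]]] := sqfree_mul_sqr n0.
    have f0 := sqfree_gt0 sf.
    have m0 : (0 < m)%N by case: m nfm n0 => // ->; rewrite muln0.
    have fz : (f < z.+1)%N.
      by apply: leq_ltn_trans (ltn_ord n); rewrite nfm leq_pmulr // expn_gt0 m0.
    have mz : (m < z.+1)%N.
      apply: leq_ltn_trans (ltn_ord n); rewrite nfm expnS expn1 mulnCA.
      by rewrite leq_pmulr // muln_gt0 f0.
    rewrite (bigD1 (Ordinal fz)) //= (bigD1 (Ordinal mz)) //= -nfm eqxx -addrA lerDl.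
    rewrite addr_ge0 //; first by apply: sumr_ge0 => k _; case: ifP.
    by apply: sumr_ge0 => g _; apply: sumr_ge0 => k _; case: ifP.
  rewrite exchange_big /=; apply: ler_sum => f _.
  rewrite exchange_big /=; apply: ler_sum => m _.
  rewrite -big_mkcond /=.
  have [h|h] := leqP (f * m ^ 2) z; last first.
    rewrite big1 ?mulr_ge0 ?invr_ge0 ?exprn_ge0 //= => n /eqP e.
    by have := ltn_ord n; rewrite e ltnS leqNgt h.
  rewrite (big_pred1 (Ordinal (h : f * m ^ 2 < z.+1)%N)) ; last by move=> n; rewrite /= -val_eqE.
  by rewrite /= natrM natrX invfM.
rewrite mulrC mulr_suml; apply: ler_sum => f _.
by rewrite -mulr_sumr ler_wpM2l // sum_inv_sqr_le2.
Qed.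

Lemma harmonic_pow2_ge j : 1 + j%:R / 2 <= \sum_(n < (2 ^ j).+1) (n%:R : R)^-1.
Proof.
elim: j => [|j IH].
  by rewrite !big_ord_recr big_ord0 /= invr0 invr1 mul0r addr0 !add0r.
rewrite -(big_mkord xpredT (fun n => (n%:R : R)^-1)) (@big_cat_nat _ _ _ (2 ^ j).+1) //=; last first.
  by rewrite ltnS leq_exp2l.
rewrite big_mkord -natr1 mulrDl addrA lerD //.
apply: (@le_trans _ _ (\sum_((2 ^ j).+1 <= i < (2 ^ j.+1).+1) ((2 ^ j.+1)%:R : R)^-1)).
  rewrite sumr_const_nat subSS (_ : (2 ^ j.+1 - 2 ^ j = 2 ^ j)%N); last by rewrite expnS; lia.
  rewrite -[X in _ <= X]mulr_natr expnS natrM invfM mul1r -mulrA mulVf ?mulr1 //.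
  by rewrite pnatr_eq0 -lt0n expn_gt0.
apply: ler_sum_nat => i /andP[hi hi2].
have i0 : (0 < i)%N by apply: leq_ltn_trans hi.
by rewrite lef_pV2 ?posrE ?ltr0n ?expn_gt0 // ler_nat.
Qed.

Lemma sqf_sum_pow2_ge j : j.+2%:R / 4 <= sqf_sum (2 ^ j).
Proof.
have := le_trans (harmonic_pow2_ge j) (harmonic_le_sqf_sum (2 ^ j)).
have -> : j.+2%:R = j%:R + 2 :> R by rewrite -addn2 natrD.
by move: (sqf_sum _) => H; lra.
Qed.

(** * The sieve majorant and its mean over intervals *)

Definition divisor_weight z n : R := \sum_(d < z.+1 | (d %| n)%N) selberg z d.

Lemma divisor_weight_prime z p : (0 < z < p)%N -> prime p -> divisor_weight z p = 1.
Proof.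
case/andP=> z0 zp pp; have h1 : (1 < z.+1)%N by [].
rewrite /divisor_weight (big_pred1 (Ordinal h1)) ?selberg1 // => d.
rewrite /= -val_eqE /=; apply/idP/eqP => [|->]; last exact: dvd1n.
case/primeP: pp => _ h /h /orP[/eqP //|/eqP dp].
by have := ltn_ord d; rewrite dp ltnS leqNgt zp.
Qed.

Lemma sum_dvd_interval e t M : (0 < e)%N ->
  `| (\sum_(s < M) (e %| t + s))%N%:R - M%:R / e%:R | <= 1 :> R.
Proof.
move=> e0.
(* Shifting by e makes the interval start just after a natural number, even for t = 0. *)
set a := (t + e).-1.
have aE : (a.+1 = t + e)%N by rewrite prednK // addn_gt0 e0 orbT.
have H : (\sum_(s < M) (e %| t + s) + a %/ e = (a + M) %/ e)%N.
  elim: M => [|M IH]; first by rewrite big_ord0 addn0.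
  rewrite big_ord_recr /= addnAC IH addnS divnS // addnC; congr (nat_of_bool _ + _)%N.
  rewrite -addSn aE. by rewrite addnAC [RHS]dvdn_addl.
move: H; set c := (\sum_(s < M) _)%N => H.
have E1 := divn_eq a e; have E2 := divn_eq (a + M) e.
have r1 := ltn_pmod a e0; have r2 := ltn_pmod (a + M) e0.
have e0R : 0 < e%:R :> R by rewrite ltr0n.
rewrite -[X in X - _](mulfK (lt0r_neq0 e0R)) -mulrBl normrM normfV (gtr0_norm e0R).
rewrite ler_pdivrMr // mul1r.
have : (c * e + (a + M) %% e = M + a %% e)%N by rewrite -H in E2; nia.
move/(congr1 (fun n => n%:R : R)); rewrite !natrD natrM => E.
have : ((a %% e)%:R < e%:R :> R) by rewrite ltr_nat.
have : (((a + M) %% e)%:R < e%:R :> R) by rewrite ltr_nat.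
have : 0 <= ((a %% e)%:R : R) by [].
have : 0 <= (((a + M) %% e)%:R : R) by [].
by move=> h1 h2 h3 h4; rewrite ler_norml; apply/andP; split; lra.
Qed.

Lemma divisor_weight_sqr z n :
  divisor_weight z n ^+ 2 =
  \sum_(d < z.+1) \sum_(e < z.+1) selberg z d * selberg z e * (lcmn d e %| n)%N%:R.
Proof.
rewrite /divisor_weight big_mkcond expr2 mulr_suml; apply: eq_bigr => d _.
rewrite mulr_sumr; apply: eq_bigr => e _; rewrite dvdn_lcm.
by case: (d %| n)%N; case: (e %| n)%N; rewrite /= ?mulr1 ?mulr0 ?mul0r.
Qed.

Lemma sum_normr_selberg_le z : (0 < z)%N ->
  \sum_(d < z.+1) `|selberg z d| <= z%:R.
Proof.
move=> z0; rewrite big_ord_recl /= selberg0 normr0 add0r.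
have -> : z%:R = \sum_(d < z) (1 : R) by rewrite sumr_const card_ord.
by apply: ler_sum => d _; apply: normr_selberg_le1.
Qed.

Lemma sum_normr_selberg2_le z : (0 < z)%N ->
  \sum_(d < z.+1) \sum_(e < z.+1) `|selberg z d * selberg z e| <= z%:R ^+ 2.
Proof.
move=> z0.
have -> : \sum_(d < z.+1) \sum_(e < z.+1) `|selberg z d * selberg z e| =
   (\sum_(d < z.+1) `|selberg z d|) ^+ 2.
  rewrite expr2 mulr_suml; apply: eq_bigr => d _; rewrite mulr_sumr.
  by apply: eq_bigr => e _; rewrite normrM.
rewrite lerXn2r ?nnegrE ?sum_normr_selberg_le //.
by apply: sumr_ge0 => d _.
Qed.

(** Opening the square, the number of multiples of [lcmn d e] in the interval is
replaced by its expected value at the cost of an error at most [1] for each of the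
[z ^ 2] pairs. *)
Lemma sum_divisor_weight_le z t M : (0 < z)%N ->
  \sum_(s < M) divisor_weight z (t + s) ^+ 2 <= M%:R / sqf_sum z + z%:R ^+ 2.
Proof.
move=> z0; under eq_bigr do rewrite divisor_weight_sqr.
rewrite exchange_big /=; under eq_bigr do rewrite exchange_big /=.
apply: (@le_trans _ _ (\sum_(d < z.+1) \sum_(e < z.+1)
   (M%:R * (selberg z d * selberg z e / (lcmn d e)%:R) + `|selberg z d * selberg z e|))).
  apply: ler_sum => d _; apply: ler_sum => e _; rewrite -mulr_sumr.
  case: (posnP d) => [->|d0]; first by rewrite selberg0 !mul0r mulr0 normr0 addr0.
  case: (posnP e) => [->|e0]; first by rewrite selberg0 !mulr0 !mul0r mulr0 normr0 addr0.
  have l0 : (0 < lcmn d e)%N by rewrite lcmn_gt0 d0.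
  have := sum_dvd_interval t M l0; rewrite natr_sum.
  set c := \sum_(s < M) _; set x := selberg z d * selberg z e => h.
  rewrite -lerBlDl mulrCA -mulrBr; apply: le_trans (ler_norm _) _.
  by rewrite normrM ler_piMr.
under eq_bigr do rewrite big_split /= -mulr_sumr.
rewrite big_split /= -mulr_sumr lerD ?sum_normr_selberg2_le //.
by rewrite ler_wpM2l // selberg_form_le.
Qed.

End Sieve.

(** * Point-line incidences *)

Section Incidence.
Variables (R : realFieldType) (F : finComUnitRingType).
Implicit Types (X A : {set F}) (u : F -> R).

Lemma sqr_sum_le_card (I : finType) (P : pred I) (x : I -> R) :
  (\sum_(i | P i) x i) ^+ 2 <= #|P|%:R * (\sum_(i | P i) x i ^+ 2).
Proof.
have [P0|P0] := posnP #|P|.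
  by rewrite P0 mul0r big_pred0 ?expr0n // => i; have := card0_eq P0 i; rewrite inE.
set S := \sum_(i | P i) x i; set c : R := #|P|%:R.
have c0 : 0 < c by rewrite ltr0n.
have : 0 <= \sum_(i | P i) (x i - S / c) ^+ 2 by apply: sumr_ge0 => i _; apply: sqr_ge0.
have -> : \sum_(i | P i) (x i - S / c) ^+ 2 =
    \sum_(i | P i) x i ^+ 2 - S / c * \sum_(i | P i) (x i + (x i - S / c)).
  by rewrite mulr_sumr -sumrB; apply: eq_bigr => i _; ring.
rewrite big_split sumrB /= -/S sumr_const -[_ *+ #|P|]mulr_natl -/c.
rewrite [c * _]mulrCA mulfV ?gt_eqF // mulr1 subrr addr0 mulrAC -expr2.
by rewrite subr_ge0 ler_pdivrMr // mulrC.
Qed.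

Lemma ler_sum_injective (I K : finType) (h : I -> K) (G : K -> R) :
  injective h -> (forall k, 0 <= G k) -> \sum_i G (h i) <= \sum_k G k.
Proof.
move=> h_inj G0.
have -> : \sum_i G (h i) = \sum_(i in [set: I]) G (h i) by apply: eq_bigl => i; rewrite inE.
rewrite -(big_imset G (in2W h_inj)) /= big_mkcond.
by apply: ler_sum => k _; case: ifP.
Qed.

(** Opening the square, a pair of distinct abscissae [x] and [y] contributes
nothing: when [t] is shifted so that the first factor is [u t], the second one runs,
as the slope [a] varies, over all the values of [u], whose sum is [0].  Each of the
[#|X|] diagonal pairs contributes the square norm of [u] once for every slope. *)
Lemma mean_zero_incidence X u :
  {in X &, forall x y, x != y -> x - y \is a GRing.unit} ->
  \sum_f u f = 0 ->
  \sum_a \sum_t (\sum_(x in X) u (a * x - t)) ^+ 2 =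
    #|F|%:R * #|X|%:R * \sum_f u f ^+ 2.
Proof.
move=> hX u0.
have reflE (c : F) (G : F -> R) : \sum_t G (c - t) = \sum_t G t.
  by rewrite [RHS](reindex_inj (h := fun t => c - t)) // => s t /addrI /oppr_inj.
have -> : \sum_a \sum_t (\sum_(x in X) u (a * x - t)) ^+ 2 =
    \sum_(x in X) \sum_(y in X) \sum_a \sum_t u (a * x - t) * u (a * y - t).
  transitivity (\sum_a \sum_(x in X) \sum_(y in X) \sum_t u (a * x - t) * u (a * y - t)).
    apply: eq_bigr => a _; rewrite [RHS](eq_bigr (fun x =>
        \sum_t \sum_(y in X) u (a * x - t) * u (a * y - t))); last first.
      by move=> x _; rewrite exchange_big.
    rewrite [RHS]exchange_big; apply: eq_bigr => t _.
    by rewrite expr2 mulr_suml; apply: eq_bigr => x _; rewrite mulr_sumr.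
  by rewrite exchange_big; apply: eq_bigr => x _; rewrite exchange_big.
have -> : #|F|%:R * #|X|%:R * (\sum_f u f ^+ 2) =
    \sum_(x in X) #|F|%:R * (\sum_f u f ^+ 2).
  by rewrite sumr_const -[RHS]mulr_natl mulrCA mulrA.
apply: eq_bigr => x xX; rewrite (bigD1 x) //= [X in _ + X]big1 ?addr0.
  transitivity (\sum_(a : F) \sum_f u f ^+ 2); last by rewrite sumr_const mulr_natl.
  apply: eq_bigr => a _; rewrite -(reflE (a * x) (fun t => u t ^+ 2)).
  by apply: eq_bigr => t _; rewrite expr2.
move=> y /andP[yX yx].
rewrite (eq_bigr (fun a => \sum_t u t * u (a * (y - x) + t))); last first.
  move=> a _; rewrite -(reflE (a * x)); apply: eq_bigr => t _.
  by congr (u _ * u _); ring.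
rewrite exchange_big big1 //= => t _; rewrite -mulr_sumr.
rewrite -(reindex_inj (h := fun a => a * (y - x) + t) (F := u) (P := xpredT)) ?u0 ?mulr0 //.
by move=> a b /addIr; apply: mulIr; apply: hX.
Qed.

(** The colours select the pairs [(i, j)] that are counted.  With colours modulo [e]
they single out the multiples of [e] among the sums, and the bound does not lose a
factor [e] because the square norms of the colour classes add up to [#|J|]. *)
Lemma coloured_incidence (I J K : finType) (tau : I -> F) (sigma : J -> F)
    (alpha : I -> K) (beta : J -> K) A X :
  injective tau -> injective sigma ->
  {in X &, forall x y, x != y -> x - y \is a GRing.unit} ->
  (\sum_i \sum_(j | alpha i == beta j)
     (\sum_(a in A) \sum_(x in X) (a * x == tau i + sigma j)%:R
        - #|A|%:R * #|X|%:R / #|F|%:R)) ^+ 2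
   <= #|F|%:R * #|A|%:R * #|X|%:R * #|I|%:R * #|J|%:R :> R.
Proof.
move=> tau_inj sigma_inj hX.
have q0 : 0 < #|F|%:R :> R by rewrite ltr0n; apply/card_gt0P; exists 0.
(* u r is the indicator function of the colour class r of sigma, minus its mean. *)
pose n r f : R := \sum_(j | r == beta j) (sigma j == f)%:R.
pose N r : R := \sum_(j | r == beta j) 1.
pose u r f : R := n r f - N r / #|F|%:R.
have sum_n r : \sum_f n r f = N r.
  rewrite exchange_big; apply: eq_bigr => j _.
  by rewrite (bigD1 (sigma j)) //= eqxx big1 ?addr0 // => f /negbTE; rewrite eq_sym => ->.
have sum_n2 r : \sum_f n r f ^+ 2 <= N r.
  rewrite -sum_n; apply: ler_sum => f _.
  have n0 : 0 <= n r f by apply: sumr_ge0.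
  have n1 : n r f <= 1.
    rewrite /n big_mkcond.
    have [/existsP[j0 /eqP j0f]|/existsPn h] := boolP [exists j, sigma j == f].
      rewrite (bigD1 j0) //= big1 ?addr0 => [|j jj0].
        by case: ifP => // _; case: eqP.
      case: ifP => // _; case: eqP => // jf; case/eqP: jj0; apply: sigma_inj.
      by rewrite jf j0f.
    by rewrite big1 // => j _; rewrite (negbTE (h j)) if_same.
  by rewrite expr2 ler_piMr.
have sum_u r : \sum_f u r f = 0.
  by rewrite sumrB sum_n sumr_const -[X in _ - X]mulr_natl mulrCA mulfV ?gt_eqF // mulr1 subrr.
have sum_u2 r : \sum_f u r f ^+ 2 <= N r.
  apply: le_trans (sum_n2 r).
  have -> : \sum_f u r f ^+ 2 = \sum_f n r f ^+ 2 - N r / #|F|%:R * \sum_f (n r f + u r f).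
    rewrite mulr_sumr -sumrB; apply: eq_bigr => f _; rewrite /u; ring.
  rewrite big_split /= sum_u addr0 sum_n gerBl mulrAC.
  by rewrite -expr2 divr_ge0 ?sqr_ge0 ?ler0n.
pose W (p : I * F) : R := \sum_(x in X) u (alpha p.1) (p.2 * x - tau p.1).
have -> : \sum_i \sum_(j | alpha i == beta j)
     (\sum_(a in A) \sum_(x in X) (a * x == tau i + sigma j)%:R
        - #|A|%:R * #|X|%:R / #|F|%:R) =
   \sum_(p | predX predT (mem A) p) W p.
  rewrite -(pair_big xpredT (mem A) (fun i a => W (i, a))) /=.
  apply: eq_bigr => i _.
  transitivity (\sum_(a in A) (\sum_(x in X) n (alpha i) (a * x - tau i)
                  - #|X|%:R * (N (alpha i) / #|F|%:R))); last first.
    by apply: eq_bigr => a _; rewrite /W sumrB sumr_const -[X in _ = _ - X]mulr_natl.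
  rewrite !sumrB; congr (_ - _); last first.
    rewrite [RHS]sumr_const -[RHS]mulr_natl.
    transitivity (#|A|%:R * #|X|%:R / #|F|%:R * N (alpha i)); last by ring.
    by rewrite /N mulr_sumr; apply: eq_bigr => j _; rewrite mulr1.
  rewrite exchange_big; apply: eq_bigr => a _; rewrite exchange_big.
  apply: eq_bigr => x _; apply: eq_bigr => j _.
  by rewrite [in RHS]eq_sym subr_eq addrC.
apply: le_trans (sqr_sum_le_card _ _) _; rewrite cardX natrM.
have -> : #|F|%:R * #|A|%:R * #|X|%:R * #|I|%:R * #|J|%:R =
   #|I|%:R * #|A|%:R * (#|F|%:R * #|X|%:R * #|J|%:R) :> R by ring.
rewrite ler_wpM2l ?mulr_ge0 //.
(* Distinct i give distinct pairs of a colour and an intercept. *)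
pose G r t := \sum_a (\sum_(x in X) u r (a * x - t)) ^+ 2.
have G0 r t : 0 <= G r t by apply: sumr_ge0 => a _; apply: sqr_ge0.
apply: (@le_trans _ _ (\sum_i G (alpha i) (tau i))).
  rewrite -(pair_big xpredT (mem A) (fun i a => W (i, a) ^+ 2)) /=.
  apply: ler_sum => i _; rewrite big_mkcond; apply: ler_sum => a _.
  by case: ifP => // _; apply: sqr_ge0.
apply: (@le_trans _ _ (\sum_(k : K * F) G k.1 k.2)).
  apply: (@ler_sum_injective _ _ (fun i => (alpha i, tau i)) (fun k => G k.1 k.2)) => //.
  by move=> i j [_ /tau_inj].
rewrite -(pair_big xpredT xpredT G) /=.
under eq_bigr do rewrite exchange_big mean_zero_incidence //.
rewrite -mulr_sumr ler_wpM2l ?mulr_ge0 //.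
apply: le_trans (ler_sum _ (fun r _ => sum_u2 r)) _.
rewrite (_ : \sum_r N r = #|J|%:R) // -sumr_const (partition_big beta xpredT) //=.
by apply: eq_bigr => r _; apply: eq_bigl => j; rewrite eq_sym.
Qed.
End Incidence.

(** * Solutions of a x = t + s weighted by the sieve *)

Lemma natr_Zp_inj q n m : (1 < q)%N -> (n < q)%N -> (m < q)%N ->
  n%:R = m%:R :> 'Z_q -> n = m.
Proof.
by move=> q1 nq mq /(congr1 val); rewrite /= !val_Zp_nat // !modn_small.
Qed.

Lemma unit_Zp_prime q (x : 'Z_q) : prime q -> x != 0 -> x \is a GRing.unit.
Proof.
move=> pq x0; have q1 := prime_gt1 pq.
rewrite -(natr_Zp x) unitZpE // prime_coprime //; apply: contra x0 => qx.
rewrite -val_eqE /=; have : (x < q)%N by rewrite -[ltnRHS](Zp_cast q1) ltn_ord.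
by case: (posnP x) => [->|x0] //; rewrite ltnNge dvdn_leq.
Qed.

Section Counting.
Variables (R : rcfType) (q : nat).
Hypothesis q_prime : prime q.
Variables (A X : {set 'Z_q}).

Let excess (n : nat) : R :=
  \sum_(a in A) \sum_(x in X) (a * x == n%:R)%:R - #|A|%:R * #|X|%:R / q%:R.

Lemma divisible_excess_le e N M : (0 < e)%N -> (N <= q)%N -> (M <= q)%N ->
  `| \sum_(t < N) \sum_(s < M) (e %| t + s)%N%:R * excess (t + s) |
    <= Num.sqrt (q%:R * #|A|%:R * #|X|%:R * N%:R * M%:R).
Proof.
case: e => // e _ Nq Mq; have q1 := prime_gt1 q_prime.
have cardq : #|'Z_q| = q by rewrite card_ord Zp_cast.
have inj L : (L <= q)%N -> injective (fun i : 'I_L => (i%:R : 'Z_q)).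
  move=> Lq i j /natr_Zp_inj h; apply: val_inj; apply: h => //.
    exact: leq_trans (ltn_ord i) Lq.
  exact: leq_trans (ltn_ord j) Lq.
have hX : {in X &, forall x y, x != y -> x - y \is a GRing.unit}.
  by move=> x y _ _ xy; rewrite unit_Zp_prime // subr_eq0.
(* The colours of t and s agree when t and - s are congruent, that is when e.+1
   divides t + s. *)
have := @coloured_incidence R _ _ _ 'I_e.+1 _ _
  (fun t : 'I_N => inZp t) (fun s : 'I_M => - inZp s) A X (inj _ Nq) (inj _ Mq) hX.
rewrite cardq !card_ord => H.
rewrite -sqrtr_sqr ler_wsqrtr //; apply: le_trans H; rewrite le_eqVlt; apply/orP; left.
apply/eqP; congr (_ ^+ 2); apply: eq_bigr => t _; rewrite [RHS]big_mkcond.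
apply: eq_bigr => s _; rewrite -addr_eq0 -val_eqE /= modnDm -/(dvdn _ _).
by rewrite -/(_ %| _)%N /excess natrD; case: ifP; rewrite ?mul1r ?mul0r.
Qed.

(** Each of the [z ^ 2] terms of the opened square has a coefficient of size at most
[1], and [divisible_excess_le] bounds it uniformly in the modulus. *)
Lemma weighted_excess_le z N M : (0 < z)%N -> (N <= q)%N -> (M <= q)%N ->
  \sum_(t < N) \sum_(s < M) divisor_weight R z (t + s) ^+ 2 * excess (t + s)
    <= z%:R ^+ 2 * Num.sqrt (q%:R * #|A|%:R * #|X|%:R * N%:R * M%:R).
Proof.
move=> z0 Nq Mq; set E := Num.sqrt _.
have -> : \sum_(t < N) \sum_(s < M) divisor_weight R z (t + s) ^+ 2 * excess (t + s) =
  \sum_(d < z.+1) \sum_(e < z.+1) selberg R z d * selberg R z e *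
    \sum_(t < N) \sum_(s < M) (lcmn d e %| t + s)%N%:R * excess (t + s).
  transitivity (\sum_(t < N) \sum_(d < z.+1) \sum_(e < z.+1) selberg R z d * selberg R z e *
    \sum_(s < M) (lcmn d e %| t + s)%N%:R * excess (t + s)).
    apply: eq_bigr => t _.
    transitivity (\sum_(s < M) \sum_(d < z.+1) \sum_(e < z.+1)
       selberg R z d * selberg R z e * ((lcmn d e %| t + s)%N%:R * excess (t + s))).
      apply: eq_bigr => s _; rewrite divisor_weight_sqr mulr_suml.
      apply: eq_bigr => d _; rewrite mulr_suml; apply: eq_bigr => e _.
      by rewrite -mulrA.
    rewrite exchange_big; apply: eq_bigr => d _; rewrite exchange_big.
    by apply: eq_bigr => e _; rewrite mulr_sumr.
  rewrite exchange_big; apply: eq_bigr => d _; rewrite exchange_big.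
  by apply: eq_bigr => e _; rewrite mulr_sumr.
apply: (@le_trans _ _ (\sum_(d < z.+1) \sum_(e < z.+1) `|selberg R z d * selberg R z e| * E)).
  apply: ler_sum => d _; apply: ler_sum => e _.
  case: (posnP d) => [->|d0]; first by rewrite selberg0 !mul0r normr0 mul0r.
  case: (posnP e) => [->|e0]; first by rewrite selberg0 mulr0 normr0 !mul0r.
  apply: le_trans (ler_norm _) _; rewrite normrM ler_wpM2l // divisible_excess_le //.
  by rewrite lcmn_gt0 d0.
under eq_bigr do rewrite -mulr_suml.
by rewrite -mulr_suml ler_wpM2r ?sqrtr_ge0 // sum_normr_selberg2_le.
Qed.

Lemma weighted_solutions_le z N M : (0 < z)%N -> (N <= q)%N -> (M <= q)%N ->
  \sum_(t < N) \sum_(s < M) divisor_weight R z (t + s) ^+ 2 *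
     (\sum_(a in A) \sum_(x in X) (a * x == (t + s)%:R)%:R)
   <= #|A|%:R * #|X|%:R / q%:R * (N%:R * (M%:R / sqf_sum R z + z%:R ^+ 2))
     + z%:R ^+ 2 * Num.sqrt (q%:R * #|A|%:R * #|X|%:R * N%:R * M%:R).
Proof.
move=> z0 Nq Mq.
have -> : \sum_(t < N) \sum_(s < M) divisor_weight R z (t + s) ^+ 2 *
     (\sum_(a in A) \sum_(x in X) (a * x == (t + s)%:R)%:R) =
   #|A|%:R * #|X|%:R / q%:R * (\sum_(t < N) \sum_(s < M) divisor_weight R z (t + s) ^+ 2)
   + \sum_(t < N) \sum_(s < M) divisor_weight R z (t + s) ^+ 2 * excess (t + s).
  rewrite mulr_sumr -big_split; apply: eq_bigr => t _ /=.
  rewrite mulr_sumr -big_split; apply: eq_bigr => s _ /=.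
  by rewrite /excess; ring.
apply: lerD; last exact: weighted_excess_le.
rewrite ler_wpM2l ?mulr_ge0 ?invr_ge0 //.
have -> : N%:R * (M%:R / sqf_sum R z + z%:R ^+ 2) =
  \sum_(t < N) (M%:R / sqf_sum R z + z%:R ^+ 2).
  by rewrite sumr_const card_ord mulr_natl.
by apply: ler_sum => t _; apply: sum_divisor_weight_le.
Qed.

End Counting.

(** * The inequality satisfied by the product set *)

Section Products.
Variables (R : rcfType) (q N M z : nat) (U : {set {unit 'Z_q}}).
Hypotheses (q_prime : prime q) (Nq : (N <= q)%N) (MN : (M <= N)%N) (zM : (0 < z < M)%N).
Hypothesis primes_in_U : forall p, prime p -> (p < N)%N -> exists2 u, u \in U & val u = p%:R.

Let A : {set 'Z_q} := [set val u | u in (U * U)%g].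
Let X : {set 'Z_q} := [set val (u^-1 : {unit 'Z_q})%g | u in U].
Let large_primes : nat := \sum_(p < N) (prime p && (M <= p)%N).

Lemma card_products : #|A| = #|(U * U)%g|.
Proof. by rewrite card_imset //; apply: val_inj. Qed.

Lemma card_inverses : #|X| = #|U|.
Proof. by rewrite card_imset // => u v /val_inj /invg_inj. Qed.

Lemma large_primes_le : (large_primes <= #|U|)%N.
Proof.
pose S := [set p : 'I_N | prime p && (M <= p)%N].
have -> : large_primes = #|S|.
  rewrite -sum1_card [RHS]big_mkcond; apply: eq_bigr => p _.
  by rewrite inE; case: (_ && _).
have inj : {in S &, injective (fun p : 'I_N => (p%:R : 'Z_q))}.
  move=> i j _ _ /natr_Zp_inj h; apply: val_inj; apply: h; first exact: prime_gt1.
    exact: leq_trans (ltn_ord i) Nq.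
  exact: leq_trans (ltn_ord j) Nq.
rewrite -(card_in_imset inj) -(card_imset U val_inj); apply: subset_leq_card.
apply/subsetP => x /imsetP[p]; rewrite inE => /andP[pp _] ->.
by have [u uU <-] := primes_in_U pp (ltn_ord p); apply: imset_f.
Qed.

(** With [s] fixed, each prime [p] in [M, N) is [t + s] for the admissible
[t = p - s]; it has sieve weight [1], and [p] times the inverse of [x] is in [A]. *)
Lemma large_primes_le_solutions x s : x \in X -> (s < M)%N ->
  large_primes%:R <= \sum_(t < N) divisor_weight R z (t + s) ^+ 2 *
      \sum_(a in A) (a * x == (t + s)%:R)%:R :> R.
Proof.
case/andP: zM => z0 zM' /imsetP[v vU ->] sM.
pose G n : nat := [&& prime n, M <= n & n < N]%N.
have : (large_primes <= \sum_(t < N) G (t + s))%N.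
  have -> : (\sum_(t < N) G (t + s) = \sum_(s <= n < N + s) G n)%N.
    by rewrite -[s in RHS]add0n big_addn addnK big_mkord.
  have -> : (large_primes = \sum_(0 <= n < N) G n)%N.
    by rewrite big_mkord; apply: eq_bigr => p _; rewrite /G ltn_ord andbT.
  have sN := leq_trans (ltnW sM) MN.
  rewrite (@big_cat_nat _ _ _ s) //= [X in (X + _ <= _)%N]big_nat_cond.
  rewrite [X in (X + _ <= _)%N]big1 ?add0n => [|n /andP[/andP[_ ns] _]].
    by rewrite [leqRHS](@big_cat_nat _ _ _ N) ?leq_addr //= leq_addr.
  by rewrite /G leqNgt (ltn_trans ns sM) andbF.
rewrite -(ler_nat R) [leRHS]natr_sum => /le_trans; apply; apply: ler_sum => t _.
rewrite /G; case: and3P => [[pp Mp pN]|_]; last first.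
  by rewrite mulr_ge0 ?sqr_ge0 //; apply: sumr_ge0.
rewrite divisor_weight_prime ?z0 ?(leq_trans zM') // expr1n mul1r.
have [w wU wp] := primes_in_U pp pN.
have aA : val (w * v)%g \in A by apply: imset_f; apply: mem_mulg.
have wE : val (w * v)%g * val (v^-1 : {unit 'Z_q})%g = (t + s)%:R.
  by rewrite -wp -[in RHS](mulgK v w).
rewrite (bigD1 (val (w * v)%g)) //= wE eqxx lerDl.
by apply: sumr_ge0.
Qed.

(** The two bounds for the weighted number of solutions with [a] in [A] and [x] in [X]:
[large_primes_le_solutions], summed over [x] and [s], and [weighted_solutions_le]. *)
Lemma prime_pairs_le :
  #|U|%:R * large_primes%:R * M%:R <=
  #|A|%:R * #|U|%:R / q%:R * (N%:R * (M%:R / sqf_sum R z + z%:R ^+ 2))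
     + z%:R ^+ 2 * Num.sqrt (q%:R * #|A|%:R * #|U|%:R * N%:R * M%:R) :> R.
Proof.
have z0 : (0 < z)%N by case/andP: zM.
have := @weighted_solutions_le R q q_prime A X z N M z0 Nq (leq_trans MN Nq).
rewrite card_inverses; apply: le_trans.
have -> : \sum_(t < N) \sum_(s < M) divisor_weight R z (t + s) ^+ 2 *
     (\sum_(a in A) \sum_(x in X) (a * x == (t + s)%:R)%:R) =
   \sum_(x in X) \sum_(s < M) \sum_(t < N) divisor_weight R z (t + s) ^+ 2 *
     (\sum_(a in A) (a * x == (t + s)%:R)%:R).
  rewrite [RHS]exchange_big [LHS]exchange_big; apply: eq_bigr => s _ /=.
  rewrite [RHS]exchange_big; apply: eq_bigr => t _ /=.
  by rewrite exchange_big mulr_sumr.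
rewrite -card_inverses -mulrA mulr_natl -sumr_const; apply: ler_sum => x xX.
rewrite mulr_natr -[X in _ *+ X](card_ord M) -sumr_const; apply: ler_sum => s _.
exact: large_primes_le_solutions.
Qed.

End Products.

(** * Choice of the parameters *)

Lemma cube_le_pow2 C : exists w0, forall w, (w0 <= w)%N -> (C * w ^ 3 <= 2 ^ w)%N.
Proof.
exists (256 * C)%N => w Cw; set m := (w %/ 4)%N.
have wm : (w < 4 * m.+1)%N by rewrite mulnC ltn_ceil.
have m2 : (m.+1 ^ 4 <= 2 ^ w)%N.
  apply: (@leq_trans ((2 ^ m) ^ 4)%N); first by rewrite leq_exp2r // ltn_expl.
  by rewrite -expnM leq_exp2l // leq_divM.
have w4 : (w ^ 4 <= 256 * m.+1 ^ 4)%N.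
  by rewrite -[256%N]/(4 ^ 4)%N -expnMn leq_exp2r // ltnW.
rewrite -(@leq_pmul2l 256) // (leq_trans _ (leq_mul (leqnn 256) m2)) //.
by apply: leq_trans w4; rewrite mulnA expnS leq_mul2r Cw orbT.
Qed.

(** In the application [y = 2^w] and [K = 2^40]; the cut-offs are [y^30] for
[N], [y^29] for [M] and [y^2] for [z], while [p] counts the primes in [M, N), [u] is
the number of residues of primes, [H] is the sieve normalisation and [a] the size of
the product set.  If [a < q / 64], then the main term is at most about
[y^30 / (32 w)], whereas Chebyshev gives [p] at least about [y^30 / (30 w)].  So the
difference [T] is at least [y^30 / (960 w)], and squaring the error term leads
to [T^3 <= q^2 y^9 <= K^2 y^89], which is false for large [y]. *)
Lemma sieve_inequality_density (R : realFieldType) (w y Q K a u p H S : R) :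
  1 <= w -> K ^+ 2 * (960 * w) ^+ 3 < y -> 2880 * w <= y ->
  0 < Q -> Q <= K * y ^+ 40 ->
  0 <= a -> a <= Q -> p <= u -> 0 <= S ->
  S ^+ 2 = Q * a * u * y ^+ 30 * y ^+ 29 ->
  y ^+ 30 <= 30 * w * (p + y ^+ 29 + 1) ->
  (w + 1) / 2 <= H ->
  u * p * y ^+ 29 <=
    a * u / Q * (y ^+ 30 * (y ^+ 29 / H + (y ^+ 2) ^+ 2)) + (y ^+ 2) ^+ 2 * S ->
  Q <= 64 * a.
Proof.
move=> w1 Ky wy Q0 QK a0 aQ pu S0 S2 cheb HH core.
rewrite leNgt; apply/negP => aQ64.
have w0 : 0 < w by lra.
have y0 : 0 < y by lra.
have y1 : 1 <= y by lra.
have yX n : 0 < y ^+ n by rewrite exprn_gt0.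
have H0 : 0 < H by lra.
have y1X n : 1 <= y ^+ n by rewrite exprn_ege1.
pose T := p - y / 64 * (y ^+ 29 / H + y ^+ 4).
have T_ge : y ^+ 30 / (960 * w) <= T.
  have p_ge : y ^+ 30 / (30 * w) - y ^+ 29 - 1 <= p.
    by rewrite !lerBlDr ler_pdivrMr ?mulr_gt0 // mulrC addrAC.
  have Hi : H^-1 <= 2 / w.
    by rewrite -[leRHS]invrK lef_pV2 ?posrE ?invr_gt0 ?divr_gt0 // invf_div; lra.
  have e1 : y ^+ 30 = y * y ^+ 29 by rewrite -exprS.
  have e2 : y * y ^+ 4 <= y ^+ 29 by rewrite -exprS ler_weXn2l.
  have h : y ^+ 29 / H <= y ^+ 29 * (2 / w) by rewrite ler_pM2l.
  have h' : y / 64 * (y ^+ 29 / H) <= y / 64 * (y ^+ 29 * (2 / w)).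
    by rewrite ler_pM2l // divr_gt0.
  have big : 3 * y ^+ 29 <= y ^+ 30 / (960 * w).
    rewrite ler_pdivlMr ?mulr_gt0 // e1.
    rewrite (_ : _ * (960 * w) = (2880 * w) * y ^+ 29); last by ring.
    by rewrite ler_pM2r.
  have e3 : y ^+ 30 / (30 * w) - y / 64 * (y ^+ 29 * (2 / w)) = 2 * (y ^+ 30 / (960 * w)).
    by rewrite e1; field; lra.
  have := y1X 29%N; rewrite /T; lra.
have T0 : 0 < T by apply: lt_le_trans T_ge; rewrite divr_gt0 // mulr_gt0.
have D0 : 0 <= y ^+ 29 / H + y ^+ 4.
  by rewrite addr_ge0 ?divr_ge0 ?(ltW (yX _)) ?(ltW H0).
have Tp : T <= p by rewrite /T lerBlDr lerDl mulr_ge0 ?divr_ge0 // ltW.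
have Tu := le_trans Tp pu.
have u0 : 0 < u := lt_le_trans T0 Tu.
have core2 : u * T * y ^+ 29 <= y ^+ 4 * S.
  have e : (y ^+ 2) ^+ 2 = y ^+ 4 by rewrite -exprM.
  have e1 : y ^+ 30 = y * y ^+ 29 by rewrite -exprS.
  rewrite e e1 in core.
  have aq : a * u / Q * (y * y ^+ 29 * (y ^+ 29 / H + y ^+ 4)) <=
      u / 64 * (y * y ^+ 29 * (y ^+ 29 / H + y ^+ 4)).
    rewrite ler_wpM2r //; first by rewrite !mulr_ge0 // ltW.
    rewrite mulrAC [leRHS]mulrC ler_wpM2r ?(ltW u0) // ler_pdivrMr //.
    by rewrite ltW // mulrC ltr_pdivlMr // mulrC.
  have := le_trans core (lerD aq (lexx _)); rewrite -lerBlDl; apply: le_trans.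
  by rewrite le_eqVlt; apply/orP; left; apply/eqP; rewrite /T; ring.
(* One factor u cancels; the other one is then at least T. *)
have sq : u * T ^+ 2 <= Q ^+ 2 * y ^+ 9.
  have h0 : 0 <= u * T * y ^+ 29 by rewrite !mulr_ge0 ?ltW.
  have := ler_pM h0 h0 core2 core2.
  have -> : y ^+ 4 * S * (y ^+ 4 * S) = Q * a * (y ^+ 9 * (u * y ^+ 58)).
    rewrite (_ : _ * _ * _ = y ^+ 8 * S ^+ 2); last by ring.
    by rewrite S2; ring.
  have -> : u * T * y ^+ 29 * (u * T * y ^+ 29) = u * T ^+ 2 * (u * y ^+ 58) by ring.
  rewrite [leRHS]mulrA ler_pM2r ?mulr_gt0 // => h; apply: le_trans h _.
  by rewrite ler_pM2r // expr2 ler_pM2l.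
have T3 : T ^+ 3 <= K ^+ 2 * y ^+ 89.
  have h1 : T ^+ 3 <= u * T ^+ 2 by rewrite exprS ler_pM2r ?exprn_gt0.
  have h2 : Q ^+ 2 <= (K * y ^+ 40) ^+ 2 by rewrite lerXn2r ?nnegrE ?(le_trans (ltW Q0) QK) ?(ltW Q0).
  apply: le_trans h1 (le_trans sq _).
  have -> : K ^+ 2 * y ^+ 89 = (K * y ^+ 40) ^+ 2 * y ^+ 9 by ring.
  by rewrite ler_pM2r.
have L0 : 0 <= y ^+ 30 / (960 * w).
  by apply: divr_ge0; [exact: ltW | apply: mulr_ge0 => //; exact: ltW].
have : (y ^+ 30 / (960 * w)) ^+ 3 <= K ^+ 2 * y ^+ 89.
  by apply: le_trans T3; rewrite lerXn2r ?nnegrE // ltW.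
rewrite expr_div_n ler_pdivrMr ?exprn_gt0 ?mulr_gt0 //.
have -> : (y ^+ 30) ^+ 3 = y * y ^+ 89 by rewrite -exprM -exprS.
by rewrite mulrAC ler_pM2r // leNgt Ky.
Qed.

Lemma sum_prime_le_large N M :
  (\sum_(p < N) prime p <= \sum_(p < N) (prime p && (M <= p)) + M)%N.
Proof.
have small : (\sum_(p < N) (p < M)%N <= M)%N.
  have -> : (\sum_(p < N) (p < M) = \sum_(p < minn N M) 1)%N.
    have [NM|MN] := leqP N M.
      by apply: eq_bigr => p _; rewrite (leq_trans (ltn_ord p)).
    rewrite (big_ord_widen_cond N xpredT (fun=> 1%N)) 1?ltnW // [RHS]big_mkcond.
    by apply: eq_bigr => p _ /=; case: (p < M)%N.
  by rewrite sum1_card card_ord geq_minr.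
apply: leq_trans _ (leq_add (leqnn _) small); rewrite -big_split; apply: leq_sum => p _ /=.
by case: (prime p); case: (leqP M p).
Qed.

(** All the parameters are powers of [2], with [w] about [log_2 q / 40]: then
[N = 2^(30 w)] is at most [q^(3/4)], and rounding the exponent changes [q] by a
factor at most [2^40], which a power of [2^w] absorbs. *)
Lemma card_products_of_primes (R : rcfType) :
  exists q0, forall q, prime q -> (q0 <= q)%N ->
  forall U : {set {unit 'Z_q}},
    (forall p, prime p -> (p ^ 4 < q ^ 3)%N -> exists2 u, u \in U & val u = p%:R) ->
    q%:R <= 64 * #|(U * U)%g|%:R :> R.
Proof.
(* K stays a variable because the unary numeral 2 ^ 40 must not be evaluated. *)
have [K KE] : exists K, K = (2 ^ 40)%N by eexists.
have [w1 hw1] := cube_le_pow2 (K ^ 2 * 960 ^ 3 + 2880).+1.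
pose w0 := maxn w1 1; exists (2 ^ (40 * w0))%N => q pq q0q U hU.
have q0 := prime_gt0 pq.
pose l := trunc_log 2 q; pose w := (l %/ 40)%N.
have ll : (40 * w0 <= l)%N by apply: trunc_log_max.
have w0w : (w0 <= w)%N by rewrite leq_divRL // mulnC.
have w_ge1 : (1 <= w)%N by apply: leq_trans w0w; rewrite leq_maxr.
have hw : ((K ^ 2 * 960 ^ 3 + 2880).+1 * w ^ 3 <= 2 ^ w)%N.
  by apply: hw1; apply: leq_trans w0w; rewrite leq_maxl.
have qlo : (2 ^ (40 * w) <= q)%N.
  by apply: leq_trans (@trunc_logP 2 q isT q0); rewrite leq_exp2l // mulnC leq_divM.
have qhi : (q <= K * 2 ^ (40 * w))%N.
  rewrite KE -expnD ltnW // (leq_trans (@trunc_log_ltn 2 q isT)) // leq_exp2l //.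
  by rewrite -mulnS mulnC ltn_ceil.
pose N := (2 ^ (30 * w))%N; pose M := (2 ^ (29 * w))%N; pose z := (2 ^ (2 * w))%N.
have Nq : (N <= q)%N by apply: leq_trans qlo; rewrite leq_exp2l // leq_mul2r orbT.
have MN : (M <= N)%N by rewrite leq_exp2l // leq_mul2r orbT.
have zM : (0 < z < M)%N.
  by rewrite expn_gt0 /= ltn_exp2l // ltn_mul2r andbT.
have primes_in_U p : prime p -> (p < N)%N -> exists2 u, u \in U & val u = p%:R.
  move=> pp pN; apply: hU => //.
  apply: (@leq_trans (N ^ 4)%N); first by rewrite ltn_exp2r.
  rewrite -expnM (_ : (30 * w * 4 = 40 * w * 3)%N); last by lia.
  by rewrite expnM leq_exp2r.
have core := @prime_pairs_le R q N M z U pq Nq MN zM primes_in_U.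
have p_le_U := @large_primes_le q N M U pq Nq primes_in_U.
have m1 : (1 < 30 * w)%N by lia.
have cheb := leq_trans (prime_count_ge m1)
   (leq_mul (leqnn _) (sum_prime_le_large N M : (_.+1 <= _.+1)%N)).
have Hs := sqf_sum_pow2_ge R (2 * w).
move: core p_le_U cheb Hs.
rewrite (card_products U) -/N -/z; set P := (\sum_(p < N) _)%N; set H := sqf_sum R z.
move=> core pU cheb Hs.
have yE n : (2 ^ (n * w))%:R = (2 ^ w)%:R ^+ n :> R by rewrite mulnC expnM natrX.
rewrite !yE in core.
have a_le : (#|(U * U)%g| <= q)%N.
  rewrite -(card_products U); apply: leq_trans (max_card _) _.
  by rewrite card_ord Zp_cast ?prime_gt1.
apply: (@sieve_inequality_density R w%:R (2 ^ w)%:R q%:R K%:R _ #|U|%:R P%:R H _ _ _ _ _ _ _ _ _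
          (sqrtr_ge0 _) _ _ _ core).
- by rewrite ler1n.
- rewrite -natrM -!natrX -natrM ltr_nat (leq_trans _ hw) // expnMn mulnA.
  by rewrite ltn_mul2r expn_gt0 w_ge1 ltnS leq_addr.
- rewrite -natrM ler_nat (leq_trans _ hw) // -[X in (X <= _)%N]mulnC mulnC leq_mul //.
    by rewrite ltnW // ltnS leq_addl.
  by rewrite -{1}(expn1 w) leq_pexp2l.
- by rewrite ltr0n.
- by rewrite -yE -natrM ler_nat.
- by rewrite ler0n.
- by rewrite ler_nat.
- by rewrite ler_nat.
- by rewrite sqr_sqrtr // !mulr_ge0 ?exprn_ge0.
- rewrite -!yE; apply: (@le_trans _ _ (30 * w * (P + M).+1)%:R).
    by rewrite ler_nat.
  by rewrite -(addn1 (P + M)) !natrM !natrD.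
- move: Hs; have -> : (2 * w).+2%:R = 2 * w%:R + 2 :> R by rewrite -addn2 natrD natrM.
  by move=> Hs; apply: le_trans Hs; rewrite le_eqVlt; apply/orP; left; apply/eqP; field.
Qed.

(** * Primes below eta q *)

Lemma primes_below_eta (R : realType) (eps : R) q p :
  0 < eps -> prime q -> prime p -> (p ^ 4 < q ^ 3)%N ->
  exists2 u, u \in primes_below q (eta_of eps q) & val u = p%:R.
Proof.
move=> eps0 pq pp pq43.
have q0 : 0 < q%:R :> R by rewrite ltr0n prime_gt0.
have q1 : 1 <= q%:R :> R by rewrite ler1n prime_gt0.
have pq_lt : (p < q)%N.
  rewrite -(@ltn_exp2r _ _ 4) // (leq_trans pq43) // leq_pexp2l //.
  exact: prime_gt0.
have pU : (p%:R : 'Z_q) \is a GRing.unit.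
  rewrite unitZpE ?prime_gt1 // prime_coprime //.
  by apply/negP => /(dvdn_leq (prime_gt0 pp)); rewrite leqNgt pq_lt.
exists (FinRing.unit 'Z_q pU) => //.
rewrite inE; apply/asboolP; exists p; split=> //.
rewrite /eta_of -[X in _ * X]powRr1 ?ltW // -powRD; last by apply/implyP => _; rewrite gt_eqF.
apply: (@lt_le_trans _ _ (q%:R `^ (3 / 4))); last first.
  by rewrite ler_powR //; lra.
rewrite -(@ltr_pXn2r _ 4) ?nnegrE ?powR_ge0 //.
rewrite -[X in _ < X]powR_mulrn ?powR_ge0 // -powRrM divfK ?pnatr_eq0 //.
by rewrite powR_mulrn ?ltW // -!natrX ltr_nat.
Qed.

Local Open Scope classical_set_scope.

Theorem theorem1 (R : realType) :
  (forall eps : R, 0 < eps -> eps <= 4^-1 ->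
    (exists (q0 : nat) (c : R), 0 < c /\
      forall q : nat, prime q -> (q0 <= q)%N ->
        c * q%:R <= #|primes_prod q (eta_of eps q) 2|%:R) /\
    (exists (o : nat -> R) (q0 : nat), o @ \oo --> (0 : R) /\
      forall q : nat, prime q -> (q0 <= q)%N ->
        ((2 * eps) / (3 + 4 * eps)) ^+ 2 * (1 + o q) * q%:R
          <= #|primes_prod q (eta_of eps q) 2|%:R)) /\
  (exists (o : nat -> R) (q0 : nat), o @ \oo --> (0 : R) /\
    forall q : nat, prime q -> (q0 <= q)%N ->
      64^-1 * (1 + o q) * q%:R
        <= #|primes_prod q (eta_of (4^-1 : R) q) 2|%:R).
Proof.
have [q0 hq0] := card_products_of_primes R.
have main eps q : 0 < eps -> prime q -> (q0 <= q)%N ->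
    64^-1 * q%:R <= #|primes_prod q (eta_of eps q) 2|%:R :> R.
  move=> eps0 pq q0q; rewrite ler_pdivrMl //.
  by apply: hq0 => // p pp; apply: primes_below_eta.
have o0 : (fun=> 0 : R) @ \oo --> (0 : R) by exact: cvg_cst.
split=> [eps eps0 eps4|]; last first.
  exists (fun=> 0), q0; split=> // q pq q0q.
  by rewrite addr0 mulr1; apply: main; rewrite ?invr_gt0.
split; first by exists q0, 64^-1; split; rewrite ?invr_gt0 // => q; apply: main.
exists (fun=> 0), q0; split=> // q pq q0q.
apply: (@le_trans _ _ (64^-1 * q%:R)); last exact: main.
rewrite addr0 mulr1 ler_wpM2r //.
have d0 : 0 < 3 + 4 * eps by lra.
have r0 : 0 <= 2 * eps / (3 + 4 * eps) by rewrite divr_ge0 //; lra.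
have r1 : 2 * eps / (3 + 4 * eps) <= 8^-1 by rewrite ler_pdivrMr //; lra.
have -> : 64^-1 = 8^-1 ^+ 2 :> R by field.
by rewrite lerXn2r ?nnegrE ?invr_ge0.
Qed.
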